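(* Let $F$ be a field with $\operatorname{char} F\neq 2$ and let $A$ be a $(2,3)$-palintropic $F$-algebra. Let $c\in\operatorname{Idm}(A)$. If $\lambda,\mu\in\sigma(c)\setminus\{\tfrac12\}$, then $$A_c(\lambda)A_c(\mu)\subset A_c(\lambda\mu).$$ Furthermore: (S1) $A_c(0)$ and $A_c(1)$ are subalgebras of $A$. (S2) If $c$ is nonsingular, then $A_c(0)=\ker L(c)$ is an ideal of $A$. (S3) If $x\in A_c(\lambda)$ and $\lambda\neq\tfrac12$, then $c\,x^\delta=\lambda^{\deg(x^\delta)}x^\delta$ for any nonassociative power $x^\delta$.
   Context: All algebras are commutative, not necessarily associative, and possibly infinite-dimensional. A commutative $F$-algebra $A$ is $(2,3)$-palintropic if $(x^3)^2-(x^2)^3=0$ for all $x\in A$, where $x^2=xx$, $x^3=x(xx)$, $(x^3)^2=x^3x^3$, $(x^2)^3=x^2(x^2x^2)$. $L(a):A\to A$ is the operator $L(a)x=ax$. $\operatorname{Idm}(A)$ is the set of nonzero idempotents ($c^2=c\ne 0$). For $\lambda\in F$, $A_c(\lambda)=\ker(L(c)-\lambda\,\mathrm{Id})$ is the Peirce subspace, and $\sigma(c)$ is the set of eigenvalues of $L(c)$. For subspaces $U,V$, $UV$ is the span of products $uv$. The idempotent $c$ is nonsingular if $\mathrm{Id}-2L(c)$ is invertible. A nonassociative power $x^\delta$ is the value at $x$ of a commutative nonassociative monomial (parenthesized word) in one variable; $\deg(x^\delta)$ is the number of occurrences of $x$ in it.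
   Formalization: The field with three elements is excluded: over F_3, with the identity required only for all x in A, the claim fails (A spanned by c, e, y with cc=c, ee=e, cy=ey=y, ce=yy=0: e is in A_c(0), y in A_c(1), but ey=y is not in A_c(0)). *)

(* Defs.v *)
From HB Require Import structures.
From mathcomp Require Import all_boot all_order all_algebra.

Set Implicit Arguments.
Unset Strict Implicit.
Unset Printing Implicit Defensive.

Import GRing.Theory.
Local Open Scope ring_scope.

(* A commutative nonassociative F-algebra is given by an F-module A (of any
   dimension), a bilinear product mul on A and a proof of commutative mul. *)
Section NonassociativeAlgebra.
Variables (F : fieldType) (A : lmodType F) (mul : {bilinear A -> A -> A}).
Implicit Types (x y z a c : A) (lam : F) (S U V : {pred A}).

Definition Lop a : A -> A := fun x => mul a x.

Definition sq x : A := mul x x.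
Definition cube x : A := mul x (mul x x).

Definition palintropic23 : Prop := forall x, sq (cube x) - cube (sq x) = 0.

Definition Idm c : Prop := mul c c = c /\ c <> 0.

Definition peirce c lam : {pred A} := [pred x | Lop c x - lam *: x == 0].

Definition spectrum c lam : Prop := exists2 x, x != 0 & x \in peirce c lam.

Definition prod_span U V z : Prop :=
  exists2 s : seq (F * (A * A)),
    (forall t, t \in s -> t.2.1 \in U /\ t.2.2 \in V) &
    z = \sum_(t <- s) t.1 *: mul t.2.1 t.2.2.

Definition subalgebra S : Prop :=
  submod_closed S /\ (forall x y, x \in S -> y \in S -> mul x y \in S).

(* For a commutative product, one-sided and two-sided ideals coincide. *)
Definition ideal S : Prop :=
  submod_closed S /\ (forall a x, x \in S -> mul a x \in S).

(* The inverse of a bijective linear map is linear, so bijectivity is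
   invertibility in End(A). *)
Definition nonsingular c : Prop := bijective (fun x => x - 2%:R *: Lop c x).

End NonassociativeAlgebra.

(* Parenthesized words in one variable.  Words that differ by swapping factors
   are the same commutative monomial; they have the same degree and, the
   product being commutative, the same value. *)
Inductive namonomial : Type :=
  | Var
  | Mul of namonomial & namonomial.

Fixpoint nadeg (d : namonomial) : nat :=
  match d with
  | Var => 1
  | Mul d1 d2 => nadeg d1 + nadeg d2
  end.

Fixpoint napow (F : fieldType) (A : lmodType F) (mul : {bilinear A -> A -> A})
    (x : A) (d : namonomial) : A :=
  match d with
  | Var => x
  | Mul d1 d2 => mul (napow mul x d1) (napow mul x d2)
  end.

(* Main.v *)
Require Import Defs.
From HB Require Import structures.
From mathcomp Require Import all_boot all_order all_algebra.
From mathcomp Require Import ring zify.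

Set Implicit Arguments.
Unset Strict Implicit.

Import GRing.Theory.
Local Open Scope ring_scope.

(** Replace [x] by [c + t y] in the identity and expand in powers of [t].  The
coefficients of [1] and [t] vanish identically and that of [t^6] is the identity
at [y]; what remains, [t^2 P_2 + t^3 P_3 + t^4 P_4 + t^5 P_5], vanishes at
[t = 1, -1, a, -a], hence every [P_k(y)] is zero ([forms_eq0]).  Write [L] for
the multiplication by [c].  Polarised, [P_2 = 0] says that
[L(pq) = L(p) L(q)] for [p], [q] in the image of [1 - 2L].  Eigenvectors with
eigenvalue other than [1/2] lie there, which gives the multiplication rule
([weight_mul]), in particular for the eigenvalues [0] and [1]; if [1 - 2L] is onto,
the rule holds for all [p], [q] and makes the kernel of [L] an ideal
([kernel_mul]).

By induction on the degree this rule gives the eigenvalues of the powers of an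
eigenvector [x] with eigenvalue [lam], as long as no smaller power of [lam]
equals [1/2].  When [lam^m = 1/2], the powers of [x] of degree [m] lie in
[A_c(1/2)], where [P_2] gives nothing, and [P_3], [P_4], [P_5] have to be used.
A model shows what to expect: let [phi] be an endomorphism of a commutative
associative unital algebra with product [x * y]; then the product
[xy = phi(x * y)] satisfies the identity, the unit [c] is idempotent, and
[L = phi].  In the model
the powers of an eigenvector [x] of [phi] are all multiples of the [n]-fold
[*]-powers of [x].  So one rescales the principal powers of [x] to vectors
[tpow n] and proves [tpow i tpow j = lam^(i+j) tpow (i+j)] together with
[L(tpow n) = lam^n tpow n] ([weighted_all]); every nonassociative power of [x]
is then a multiple of some [tpow n] ([napow_tpow]).

The induction is on [N = i + j].  The unknowns are the products
[E i = tpow i tpow (N - i)] and their defects [D (E i)], [D = L - lam^N].  On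
products of lower powers [P_3], [P_4] and [P_5] become linear relations
([level3], [level4], [level5]).  The last one is free of [D] and expresses
[E (k + 3)] through [E 1, ..., E (k + 2)] and [E 3], so it is enough to know
that [E 1 = E 2 = E 3]; then [level4] reduces to [2 D (E 2) = 0].  The equality
of these three vectors is an elimination problem ([top_products_agree]) in which
[P_2] annihilates the defects except for finitely many relations between [lam]
and [lam^N].  In each exceptional case, applying [D] to the relations gives
further relations, and the elimination ends with conditions on one vector that
have no nonzero common solution, whatever the characteristic. *)

(** * Linear combinations in a module *)

(** Syntax of vector expressions over a list of atoms, on which equality of
two vectors is reduced to ring equations between the coefficients of the atoms. *)
Inductive vexp (F : Type) : Type :=
  | Vzero
  | Vvar of nat
  | Vadd of vexp F & vexp F
  | Vopp of vexp F
  | Vscale of F & vexp F.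

Arguments Vzero {F}.
Arguments Vvar {F}.

Section ModuleNormalisation.
Variables (F : fieldType) (A : lmodType F).

Fixpoint veval (env : seq A) (e : vexp F) : A :=
  match e with
  | Vzero => 0
  | Vvar i => nth 0 env i
  | Vadd e1 e2 => veval env e1 + veval env e2
  | Vopp e1 => - veval env e1
  | Vscale k e1 => k *: veval env e1
  end.

Fixpoint vcoef (e : vexp F) (i : nat) : F :=
  match e with
  | Vzero => 0
  | Vvar j => if Nat.eqb i j then 1 else 0
  | Vadd e1 e2 => vcoef e1 i + vcoef e2 i
  | Vopp e1 => - vcoef e1 i
  | Vscale k e1 => k * vcoef e1 i
  end.

Lemma veval_coef env e :
  veval env e = \sum_(i < size env) vcoef e i *: nth 0 env i.
Proof.
elim: e => [|j|e1 IH1 e2 IH2|e IH|k e IH] /=.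
- by rewrite big1 // => i _; rewrite scale0r.
- have eqbE (i : nat) : Nat.eqb i j = (i == j) by apply/idP/eqP => /PeanoNat.Nat.eqb_eq.
  have [lt_j|le_j] := ltnP j (size env).
    rewrite (bigD1 (Ordinal lt_j)) //= eqbE eqxx scale1r big1 ?addr0 // => i.
    rewrite -val_eqE /= eqbE => /negPf ->; exact: scale0r.
  rewrite nth_default // big1 // => i _; rewrite eqbE.
  by rewrite (ltn_eqF (leq_trans (ltn_ord i) le_j)) scale0r.
- by rewrite IH1 IH2 -big_split; apply: eq_bigr => i _; rewrite scalerDl.
- by rewrite IH -sumrN; apply: eq_bigr => i _; rewrite scaleNr.
- by rewrite IH scaler_sumr; apply: eq_bigr => i _; rewrite scalerA.
Qed.

Fixpoint vcoefs_eq (n : nat) (e1 e2 : vexp F) : Prop :=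
  match n with
  | 0 => True
  | n'.+1 => vcoef e1 n' = vcoef e2 n' /\ vcoefs_eq n' e1 e2
  end.

Lemma veval_eq env e1 e2 :
  vcoefs_eq (size env) e1 e2 -> veval env e1 = veval env e2.
Proof.
rewrite !veval_coef => eq12; apply: eq_bigr => i _; congr (_ *: _).
elim: (size env) eq12 i => [|n IHn] /= => [_ []//|[eqn /IHn{}IHn] i].
have [lt_i|] := ltnP i n; first exact: (IHn (Ordinal lt_i)).
by move=> le_n; have /eqP -> : i == n :> nat by rewrite eqn_leq le_n -ltnS ltn_ord.
Qed.

Lemma lincomb k (x y : A) : x = y -> k *: (x - y) = 0.
Proof. by move=> ->; rewrite subrr scaler0. Qed.

Lemma lincombS k (x y z : A) : x = y -> z = 0 -> k *: (x - y) + z = 0.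
Proof. by move=> /lincomb -> ->; rewrite addr0. Qed.

Lemma from_lincomb (x y z : A) : z = 0 -> x - y = z -> x = y.
Proof. by move=> -> /subr0_eq. Qed.

Lemma scale_cancel k (x : A) : k != 0 -> k *: x = 0 -> x = 0.
Proof. by move=> k0 /eqP; rewrite scaler_eq0 (negPf k0) => /eqP. Qed.

End ModuleNormalisation.

Ltac vmem x l :=
  lazymatch l with
  | nil => constr:(false)
  | cons x _ => constr:(true)
  | cons _ ?l' => vmem x l'
  end.

Ltac vindex x l :=
  lazymatch l with
  | cons x _ => constr:(0%N)
  | cons _ ?l' => let i := vindex x l' in constr:(S i)
  end.

Ltac vatoms l e :=
  lazymatch e with
  | 0 => l
  | ?a + ?b => let l := vatoms l a in vatoms l b
  | - ?a => vatoms l a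
  | _ *: ?a => vatoms l a
  | _ => lazymatch vmem e l with
         | true => l
         | false => constr:(cons e l)
         end
  end.

Ltac vreify F l e :=
  lazymatch e with
  | 0 => constr:(@Vzero F)
  | ?a + ?b =>
      let a := vreify F l a in let b := vreify F l b in constr:(@Vadd F a b)
  | - ?a => let a := vreify F l a in constr:(@Vopp F a)
  | ?k *: ?a => let a := vreify F l a in constr:(@Vscale F k a)
  | _ => let i := vindex e l in constr:(@Vvar F i)
  end.

Ltac solve_vcoefs :=
  lazymatch goal with
  | |- True => exact I
  | |- _ /\ _ => split; [ring | solve_vcoefs]
  end.

Ltac module_ring :=
  lazymatch goal with
  | |- @eq ?T ?x ?y =>
      let A := match goal with AA : lmodType ?F |- _ => constr:(AA) end in
      let F := match type of A with lmodType ?F => constr:(F) end in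
      let F' := constr:(GRing.Field.sort F) in
      let l := vatoms (@nil A) x in
      let l := vatoms l y in
      let ex := vreify F' l x in
      let ey := vreify F' l y in
      refine (@veval_eq F A l ex ey _);
      cbn [vcoefs_eq vcoef size Nat.eqb];
      solve_vcoefs
  end.

(** Lets a relation between scalars take part, once applied to a vector, in a
linear combination of vector equations. *)
Lemma scale_eq (F : fieldType) (A : lmodType F) (v : A) (p q : F) : p = q -> p *: v = q *: v.
Proof. by move=> ->. Qed.

(* [lc a P b Q ...] proves an equation as the combination with coefficients
   [a], [b], ... of the equations [P], [Q], ...; [rc] does the same for scalars. *)
Ltac lc1 a P := apply: (from_lincomb (lincomb a P)); module_ring.
Ltac lc2 a P b Q := apply: (from_lincomb (lincombS a P (lincomb b Q))); module_ring.
Ltac lc3 a P b Q c S :=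
  apply: (from_lincomb (lincombS a P (lincombS b Q (lincomb c S)))); module_ring.
Ltac lc4 a P b Q c S d T :=
  apply: (from_lincomb (lincombS a P (lincombS b Q (lincombS c S (lincomb d T)))));
  module_ring.

Lemma ringcomb (F : fieldType) (k x y : F) : x = y -> k * (x - y) = 0.
Proof. by move=> ->; rewrite subrr mulr0. Qed.

Lemma ringcombS (F : fieldType) (k x y z : F) : x = y -> z = 0 -> k * (x - y) + z = 0.
Proof. by move=> /ringcomb -> ->; rewrite addr0. Qed.

Lemma from_ringcomb (F : fieldType) (x y z : F) : z = 0 -> x - y = z -> x = y.
Proof. by move=> -> /subr0_eq. Qed.

Ltac rc1 a P := apply: (from_ringcomb (ringcomb a P)); ring.
Ltac rc2 a P b Q := apply: (from_ringcomb (ringcombS a P (ringcomb b Q))); ring.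
Ltac rc3 a P b Q c S :=
  apply: (from_ringcomb (ringcombS a P (ringcombS b Q (ringcomb c S)))); ring.

Ltac nonzero :=
  rewrite ?(oppr_eq0, mulf_eq0, expf_eq0) /= ?andbF ?negb_or;
  repeat (apply/andP; split); assumption.

(** * Elimination of the top products *)

Definition is_linear (F : fieldType) (A : lmodType F) (f : A -> A) :=
  forall t x y, f (t *: x + y) = t *: f x + f y.

Section Elimination.
(* Here [l] is the eigenvalue of [x], [n = l^(N-3)], [e = E 1], [v = E 2 - E 1],
   [w = E 3 - E 1] and [w4 = E 4 - E 1], where [E i] is the product of the powers
   of degrees [i] and [N - i] of [x] and [D = L - l^N] measures how far they are
   from being eigenvectors.  [N1] to [N4] come from the quadratic form; [EA],
   [EC], [E22], [E13] from the cubic form in degrees (1, 1, N-2), (1, 2, N-3),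
   (2, 2, N-4), (1, 3, N-4); [EB] from the quartic form in degrees
   (1, 1, 1, N-3); [EP] from the quintic form in degrees (1, 1, 1, 1, N-4). *)
Variables (F : fieldType) (A : lmodType F) (D : A -> A).
Hypothesis Dlin : is_linear D.
Variables (l n : F) (e v w w4 : A).
Hypotheses (n2 : (2 : F) != 0) (nl : l != 0) (nn : n != 0) (nl1 : 1 - l != 0)
  (nlm1 : 1 + l != 0) (nlh : 1 - 2 * l != 0).
Hypothesis N1 : (1 - 2 * l ^+ 2 * n) *: D e = 0.
Hypothesis N2 : ((1 - 2 * l ^+ 2) * (1 - 2 * l * n)) *: (D e + D v) = 0.
Hypothesis N3 : ((1 - 2 * l ^+ 3) * (1 - 2 * n)) *: (D e + D w) = 0.
Hypothesis N4 : ((1 - 2 * l ^+ 4) * (l - 2 * n)) *: (D e + D w4) = 0.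
Hypothesis EA : (2 * n * (1 - 2 * l)) *: D e + (1 - 2 * l * n) *: (D e + D v)
  = - (2 * l ^+ 2 * n * (1 - n) * (1 - 2 * l)) *: v.
Hypothesis EB : 2 *: (D e + D v) =
  (2 * l * (3 * l * n + l ^+ 2 - n - l)) *: v + (l ^+ 2 * (2 * n + 1 - 4 * l)) *: w.
Hypothesis EC : (l * n * (1 - 2 * l)) *: D e + (n * (1 - 2 * l ^+ 2)) *: (D e + D v)
    + (l ^+ 2 * (1 - 2 * n)) *: (D e + D w)
  = - (l ^+ 2 * n) *: (((l - l ^+ 2) * (1 - 2 * n)) *: v
       + ((l - n) * (1 - 2 * l ^+ 2)) *: w
       + ((l ^+ 2 - n) * (1 - 2 * l)) *: (w - v)).
Hypothesis EP : (2 * l * n + l ^+ 3 - 2 * n + 2 * l ^+ 2) *: v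
    + (2 * (l * n + n - l ^+ 2)) *: w = l ^+ 3 *: w4.
Hypothesis E22 : (2 * (1 - 2 * l ^+ 2) * n) *: (D e + D v)
    + ((l - 2 * n) * l ^+ 2) *: (D e + D w4)
  = (2 * l * n * (l ^+ 3 - n) * (1 - 2 * l ^+ 2)) *: (v - w4).
Hypothesis E13 : ((1 - 2 * l) * l ^+ 2 * n) *: D e
    + ((1 - 2 * l ^+ 3) * n) *: (D e + D w) + ((l - 2 * n) * l ^+ 3) *: (D e + D w4)
  = (l ^+ 2 * n) *: (- ((l - l ^+ 3) * (l - 2 * n)) *: w
       - ((l ^+ 2 - n) * (1 - 2 * l ^+ 3)) *: w4
       + ((l ^+ 4 - n) * (1 - 2 * l)) *: (w - w4)).

Let D0 : D 0 = 0.
Proof. by have := Dlin (-1) 0 0; rewrite scaler0 addr0 scaleN1r addNr. Qed.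
Let Dscale (k : F) (x : A) : D (k *: x) = k *: D x.
Proof. by have := Dlin k x 0; rewrite D0 !addr0. Qed.
Let Dadd (x y : A) : D (x + y) = D x + D y.
Proof. by have := Dlin 1 x y; rewrite !scale1r. Qed.
Let Dopp (x : A) : D (- x) = - D x.
Proof. by rewrite -scaleN1r Dscale scaleN1r. Qed.

Let DA : (2 * n * (1 - 2 * l)) *: D (D e) + (1 - 2 * l * n) *: (D (D e) + D (D v))
  = - (2 * l ^+ 2 * n * (1 - n) * (1 - 2 * l)) *: D v.
Proof.
have H := congr1 D EA; rewrite !(Dadd, Dscale, Dopp) in H.
lc1 (1 : F) H.
Qed.
Let DB : 2 *: (D (D e) + D (D v)) =
  (2 * l * (3 * l * n + l ^+ 2 - n - l)) *: D v + (l ^+ 2 * (2 * n + 1 - 4 * l)) *: D w.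
Proof.
have H := congr1 D EB; rewrite !(Dadd, Dscale, Dopp) in H.
lc1 (1 : F) H.
Qed.
Let DC : (l * n * (1 - 2 * l)) *: D (D e) + (n * (1 - 2 * l ^+ 2)) *: (D (D e) + D (D v))
    + (l ^+ 2 * (1 - 2 * n)) *: (D (D e) + D (D w))
  = - (l ^+ 2 * n) *: (((l - l ^+ 2) * (1 - 2 * n)) *: D v
       + ((l - n) * (1 - 2 * l ^+ 2)) *: D w
       + ((l ^+ 2 - n) * (1 - 2 * l)) *: (D w - D v)).
Proof.
have H := congr1 D EC; rewrite !(Dadd, Dscale, Dopp) in H.
lc1 (1 : F) H.
Qed.
Let DP : (2 * l * n + l ^+ 3 - 2 * n + 2 * l ^+ 2) *: D v
    + (2 * (l * n + n - l ^+ 2)) *: D w = l ^+ 3 *: D w4.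
Proof.
have H := congr1 D EP; rewrite !(Dadd, Dscale, Dopp) in H.
lc1 (1 : F) H.
Qed.

(** [EA] gives [v = 0], and then [EB] and [EC] make [w] a multiple of zero: their
coefficients [2 n + 1 - 4 l] and [(l - n)(1 - 2 l^2) + (l^2 - n)(1 - 2 l)] have a
common zero only if [(1 - 2 l)^2 = 0].  Only if [2 l^3 = 1] can [D w] disturb
[EC]; then [E22] and [E13] finish. *)
Lemma nu_ne1_elim : D e = 0 -> D v = 0 -> n != 1 -> v = 0 /\ w = 0.
Proof using Dlin n2 nl nn nl1 nlh N3 N4 EA EB EC E22 E13.
move=> De Dv n1; have n1' : 1 - n != 0 by rewrite subr_eq0 eq_sym.
have v0 : v = 0.
  apply: (@scale_cancel _ _ (2 * l ^+ 2 * n * (1 - n) * (1 - 2 * l))); first by nonzero.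
  move: EA; rewrite De Dv => H; lc1 (1 : F) H.
split=> //; move: EB EC E22 E13 N3 N4; rewrite v0 De ?D0 !add0r => B C G22 G13 M3 M4.
have Kw : (2 * n + 1 - 4 * l) *: w = 0.
  apply: (@scale_cancel _ _ (l ^+ 2)); first by nonzero.
  lc1 (-1 : F) B.
have [h|nk] := eqVneq (2 * n + 1 - 4 * l) 0; last exact: scale_cancel nk Kw.
have [hn|nn1] := eqVneq (2 * n) 1.
  apply: (@scale_cancel _ _ (2 * (1 - 2 * l))); first by nonzero.
  lc2 (1 : F) Kw (-1 : F) (scale_eq w hn).
have {}nn1 : 1 - 2 * n != 0 by rewrite subr_eq0 eq_sym.
have [hl|nl3] := eqVneq (1 - 2 * l ^+ 3) 0; last first.
  have Dw : D w = 0 by apply: scale_cancel M3; nonzero.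
  move: C; rewrite Dw => C.
  apply: (@scale_cancel _ _ (2 * l ^+ 2 * n * (1 - 2 * l) ^+ 2)); first by nonzero.
  lc2 (2 : F) C ((2 - 2 * l - 2 * l ^+ 2) * l ^+ 2 * n) Kw.
(* [l = 2 n = 4 l - 1] and [2 l^3 = 1] force characteristic 5 and [n = 1] *)
have nl2n : l - 2 * n != 0.
  apply/eqP => hl2n.
  have h3 : 3 * l = 1 by rc2 (-1 : F) h (-1 : F) hl2n.
  have h5 : 5 = 0 :> F.
    apply/eqP; rewrite -[5 == 0]orbb -mulf_eq0; apply/eqP.
    rc2 (27 : F) hl (2 * (9 * l ^+ 2 + 3 * l + 1) : F) h3.
  case/eqP: n1; rc3 (1 : F) h3 (-3 : F) hl2n (-n : F) h5.
have w40 : w4 = 0.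
  have nln : l ^+ 3 - n != 0.
    apply/eqP => h'; case/eqP: nn1; rc2 (1 : F) hl (2 : F) h'.
  have nl2 : 1 - 2 * l ^+ 2 != 0.
    apply/eqP => h'; case/eqP: nl1; rc2 (1 : F) hl (-l : F) h'.
  have Dw4 : D w4 = 0.
    apply: scale_cancel M4; rewrite mulf_neq0 //.
    have -> : 1 - 2 * l ^+ 4 = (1 - l) + l * (1 - 2 * l ^+ 3) by ring.
    by rewrite hl mulr0 addr0.
  move: G22; rewrite Dw4 => G.
  apply: (@scale_cancel _ _ (2 * l * n * (l ^+ 3 - n) * (1 - 2 * l ^+ 2))); first by nonzero.
  lc1 (1 : F) G.
have {M4} Dw4 : D w4 = 0 by rewrite w40 D0.
move: G13; rewrite Dw4 w40 => G.
apply: (@scale_cancel _ _ (l ^+ 2 * n * 2 * (1 - 2 * l) * (l - 2 * n))); first by nonzero.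
have hz (z : A) := scale_eq z hl.
lc3 (-2 : F) G (2 * n : F) (hz (D w)) (l ^+ 2 * n * (2 * l - 2 * n - 2 * l ^+ 2) : F) (hz w).
Qed.

(** For [n = 1] the relation [EA] is void.  Eliminating between [EB] and [EC]
shows that [q = 8 l^2 + 5 l - 4] annihilates [v] and [w], and reducing modulo [q]
gives [v = - 2 w]; then [EP] and [E13], with [E22] unless [l^3 = 1], leave
conditions on [w] without a common nonzero solution. *)
Lemma nu_eq1_elim : D e = 0 -> D v = 0 -> n = 1 -> 1 - 2 * l ^+ 2 != 0 -> v = 0 /\ w = 0.
Proof using Dlin n2 nl nl1 nlm1 nlh N3 N4 EB EC EP E22 E13 DB DP.
move=> De Dv n1 nl2; move: EB EC EP E22 E13 DB DP N3 N4.
rewrite n1 De Dv ?D0 => B C P G22 G13 B' P' M3 M4.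
have Dw : D w = 0.
  have [hl|nl3] := eqVneq (1 - 2 * l ^+ 3) 0; last first.
    apply: (scale_cancel nl3); lc1 (-1 : F) M3.
  have [h|n34] := eqVneq (3 - 4 * l) 0; last first.
    apply: (@scale_cancel _ _ (l ^+ 2 * (3 - 4 * l))); first by nonzero.
    lc1 (-1 : F) B'.
  (* [2 l^3 = 1] and [4 l = 3] force characteristic 5 and [l = 2] *)
  have h5 : 5 = 0 :> F.
    rc2 (32 : F) hl (- (9 + 12 * l + 16 * l ^+ 2) : F) h.
  have hl2 : l = 2 by rc2 (1 : F) h (l - 1 : F) h5.
  have w4v : v - w4 = 0.
    apply: (@scale_cancel _ _ (2 * l * (l ^+ 3 - 1) * (1 - 2 * l ^+ 2))).
      have -> : 2 * l * (l ^+ 3 - 1) * (1 - 2 * l ^+ 2)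
        = - l * (1 - 2 * l ^+ 2) + - (l * (1 - 2 * l ^+ 2)) * (1 - 2 * l ^+ 3) by ring.
      by rewrite hl mulr0 addr0; nonzero.
    lc2 (-1 : F) G22 (l ^+ 2 : F) (scale_eq (D w4) hl2).
  have Dw4 : D w4 = 0 by rewrite -(subr0_eq w4v).
  move: P'; rewrite Dw4 => P'.
  apply: (@scale_cancel _ _ 2) => //.
  lc2 (-1 : F) P' (-2 * (l + 1) : F) (scale_eq (D w) hl2).
have Dw4 : D w4 = 0.
  apply: (@scale_cancel _ _ (l ^+ 3)); first by nonzero.
  move: P'; rewrite Dw => P'; lc1 (-1 : F) P'.
move: B C G22 G13; rewrite Dw Dw4 => B C G22 G13 {M3 M4 B' P'}.
have Q1 : (2 * (l ^+ 2 + 2 * l - 1)) *: v + (l * (3 - 4 * l)) *: w = 0.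
  apply: (scale_cancel nl); lc1 (-1 : F) B.
have Q2 : (2 * l ^+ 2 + 2 * l - 1) *: v + (2 - l - 4 * l ^+ 2) *: w = 0.
  apply: (@scale_cancel _ _ (l ^+ 2 * (1 - l))); first by nonzero.
  lc1 (-1 : F) C.
have qv : (8 * l ^+ 2 + 5 * l - 4) *: v = 0.
  apply: (scale_cancel nlh).
  lc2 (2 - l - 4 * l ^+ 2 : F) Q1 (- (l * (3 - 4 * l)) : F) Q2.
have qw : (8 * l ^+ 2 + 5 * l - 4) *: w = 0.
  apply: (scale_cancel nlh).
  lc2 (- (2 * l ^+ 2 + 2 * l - 1) : F) Q1 (2 * (l ^+ 2 + 2 * l - 1) : F) Q2.
have [hq|nq] := eqVneq (8 * l ^+ 2 + 5 * l - 4) 0; last first.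
  by rewrite (scale_cancel nq qv) (scale_cancel nq qw).
(* in characteristic 3, [q = - (l - 1)^2] *)
have n3 : (3 : F) != 0.
  apply/eqP => h3; have /eqP : (1 - l) ^+ 2 = 0.
    rc2 (-1 : F) hq (3 * l ^+ 2 + l - 1 : F) h3.
  by rewrite expf_eq0 /= (negPf nl1).
(* modulo [q], four times the left-hand side of [Q2] is [3 l (v + 2 w)] *)
have vw : v + 2 *: w = 0.
  apply: (@scale_cancel _ _ (3 * l)); first by nonzero.
  lc3 (4 : F) Q2 (-1 : F) qv (2 : F) qw.
suff w0 : w = 0 by split=> //; move: vw; rewrite w0 scaler0 addr0.
have Q5 : (2 * l ^+ 3 - 2 * l ^+ 2 + 4 * l - 1) *: w
    + (2 + l ^+ 2 - 2 * l - 4 * l ^+ 3) *: w4 = 0.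
  apply: (@scale_cancel _ _ (l ^+ 2 * (1 - l) * (1 + l))); first by nonzero.
  lc1 (-1 : F) G13.
(* [l^3 = 1] and [q = 0] give [l = -4] and characteristic 13 *)
have [hl|nl3] := eqVneq (l ^+ 3 - 1) 0.
  have hl2 : l ^+ 2 + l + 1 = 0.
    by apply/eqP; rewrite -(mulrI_eq0 _ (mulfI nl1)); apply/eqP; rc1 (-1 : F) hl.
  have hl4 : l + 4 = 0.
    by apply/eqP; rewrite -(mulrI_eq0 _ (mulfI n3)); apply/eqP; rc2 (-1 : F) hq (8 : F) hl2.
  have hlm : l = - 4 by rc1 (1 : F) hl4.
  have h13 : 13 = 0 :> F by rc2 (1 : F) hl2 (3 - l : F) hl4.
  move: P Q5; rewrite hlm => P Q5; apply: (scale_cancel n3).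
  lc4 (45 * 47 : F) P (-20 * 24 : F) Q5 (30 * 47 * 63 : F) vw
    (- (100 * 140 + 19) : F) (scale_eq w h13).
have w4v : v - w4 = 0.
  apply: (@scale_cancel _ _ (2 * l * (l ^+ 3 - 1) * (1 - 2 * l ^+ 2))); first by nonzero.
  lc1 (-1 : F) G22.
have h7 : (12 + 7 * l) *: w = 0.
  lc4 (4 : F) P (-4 * (2 * l - 2 + 2 * l ^+ 2) : F) vw (-4 * l ^+ 3 : F) w4v (3 : F) qw.
have h23 : (23 * l - 12) *: w = 0.
  apply: (@scale_cancel _ _ (3 * 3 * 3)); first by nonzero.
  lc4 (32 : F) Q5 (-32 * (2 + l ^+ 2 - 2 * l - 4 * l ^+ 3) : F) vw
    (32 * (2 + l ^+ 2 - 2 * l - 4 * l ^+ 3) : F) w4v (- (40 * l - 41) : F) qw.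
(* the sum of [h7] and [h23] is [30 l w = 0] *)
have [h5|n5] := eqVneq (5 : F) 0.
  apply: (@scale_cancel _ _ (2 * (1 + l))); first by nonzero.
  lc2 (1 : F) h7 (- (2 + l) : F) (scale_eq w h5).
apply: (@scale_cancel _ _ (2 * 3 * 5 * l)); first by nonzero.
lc2 (1 : F) h7 (1 : F) h23.
Qed.

(** Here [l^(N-1) = 1/2], so [D e] is not controlled by [N1]; but
[D v = D w = - D e], and the images of [EA], [EB], [EC] under [D] become
multiples of [D e], with coefficients that have no common zero. *)
Lemma first_defect_generic : 1 - 2 * l ^+ 2 * n = 0 -> 1 - 2 * l ^+ 2 != 0 ->
  1 - 2 * l ^+ 3 != 0 -> v = 0 /\ w = 0.
Proof using Dlin n2 nl nn nl1 nlm1 nlh N2 N3 N4 EA EB EC E22 E13 DB DC.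
move=> hn nl2 nl3.
have hz (z : A) := scale_eq z hn.
have De2 : D e + D v = 0.
  apply: (scale_cancel _ N2); apply: mulf_neq0 => //; apply/eqP => h.
  by case/eqP: nl1; rc2 (1 : F) hn (-l : F) h.
have De3 : D e + D w = 0.
  apply: (scale_cancel _ N3); apply: mulf_neq0 => //; apply/eqP => h.
  have /eqP : (1 - l) * (1 + l) = 0 by rc2 (1 : F) hn (- l ^+ 2 : F) h.
  by rewrite mulf_eq0 (negPf nl1) (negPf nlm1).
have Dv : D v = - D e by lc1 (1 : F) De2.
have Dw : D w = - D e by lc1 (1 : F) De3.
have DDv : D (D v) = - D (D e) by rewrite Dv Dopp.
have DDw : D (D w) = - D (D e) by rewrite Dw Dopp.
have DDe : D (D e) = (l ^+ 2 * (1 - n)) *: D e.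
  apply: (@subr0_eq _ _ _); apply: (@scale_cancel _ _ (2 * n * (1 - 2 * l))); first by nonzero.
  move: DA; rewrite DDv Dv => H; lc1 (1 : F) H.
have cub : (2 * l ^+ 3 + 3 * l ^+ 2 + 3 * l - 1) *: D e = 0.
  apply: (@scale_cancel _ _ (l * (1 - l))); first by nonzero.
  move: DB; rewrite DDv Dv Dw => H.
  lc2 (l ^+ 2 : F) H (- (l * (1 - 4 * l)) : F) (hz (D e)).
have quart : (2 * l + 1) *: D e = 0.
  apply: (@scale_cancel _ _ (n * (1 - l) * (1 - 2 * l ^+ 3))); first by nonzero.
  move: DC; rewrite DDv DDw DDe Dv Dw => H.
  lc2 (2 : F) H (n * (1 + l - 2 * l ^+ 2) : F) (hz (D e)).
have De : D e = 0.
  apply: (@scale_cancel _ _ (2 * 2 * 2)); first by nonzero.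
  (* [2 l^3 + 3 l^2 + 3 l - 1 = -2] at [l = -1/2] *)
  lc2 (-4 : F) cub (4 * l ^+ 2 + 4 * l + 4 : F) quart.
apply: nu_ne1_elim => //; first by rewrite Dv De oppr0.
by apply: contra_neq nl2 => n1; rewrite -[RHS]hn n1 mulr1.
Qed.

(** Both [N1] and [N3] are void.  [EB] and [E22] give [w = 4 v] and [w4 = v];
[EP] then gives [2 l v = - 3 v], and [E13] turns this into [29 v = 0]. *)
Lemma first_defect_cubic : 1 - 2 * l ^+ 3 = 0 -> n = l -> v = 0 /\ w = 0.
Proof using Dlin n2 nl nl1 nlm1 nlh N2 N4 EA EB EP E22 E13.
move=> hl hn.
have hz (z : A) := scale_eq z hl.
have nl2 : 1 - 2 * l ^+ 2 != 0.
  by apply/eqP => h; case/eqP: nl1; rc2 (1 : F) hl (-l : F) h.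
move: N2 N4 EA EB EP E22 E13; rewrite hn => M2 M4 HA HB P G22 G13.
have De2 : D e + D v = 0.
  apply: (scale_cancel _ M2).
  have -> : 1 - 2 * l * l = 1 - 2 * l ^+ 2 by ring.
  exact: mulf_neq0.
have De4 : D e + D w4 = 0.
  apply: (scale_cancel _ M4).
  have -> : (1 - 2 * l ^+ 4) * (l - 2 * l) = - ((1 - l) * l) + - l ^+ 2 * (1 - 2 * l ^+ 3).
    by ring.
  by rewrite hl mulr0 addr0; nonzero.
move: HA HB G22 G13; rewrite De2 De4 => HA HB G22 G13.
have wv : w - 4 *: v = 0.
  apply: (@scale_cancel _ _ (l ^+ 2 * (1 - 2 * l))); first by nonzero.
  lc1 (-1 : F) HB.
have w4v : v - w4 = 0.
  apply: (@scale_cancel _ _ (2 * l ^+ 3 * (1 - l) * (1 + l) * (1 - 2 * l ^+ 2))).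
    by nonzero.
  lc1 (1 : F) G22.
have e1 : D e = - (l ^+ 2 * (1 - l)) *: v.
  apply: (@subr0_eq _ _ _); apply: (@scale_cancel _ _ (2 * l * (1 - 2 * l))); first by nonzero.
  lc1 (1 : F) HA.
have k1 : (2 * l + 3) *: v = 0.
  apply: (@scale_cancel _ _ (2 * l)); first by nonzero.
  lc3 (1 : F) P (- 2 * l : F) wv (- l ^+ 3 : F) w4v.
have k2 : (2 * l ^+ 2 - 2 * l + 7) *: v = 0.
  apply: (@scale_cancel _ _ (l ^+ 4 * (1 - 2 * l))); first by nonzero.
  move: (hz (D e + D w)) G13.
  rewrite e1 (subr0_eq wv) -(subr0_eq w4v) => hX G13'.
  lc3 (2 : F) G13' (-2 * l : F) hX (l ^+ 3 * (3 * l + 4 * l ^+ 2) : F) (hz v).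
have k29 : 29 *: v = 0 by lc2 (2 : F) k2 (- (2 * l - 5) : F) k1.
(* [(2 l)^3 = 4] and [2 l v = - 3 v] also give [31 v = 0] *)
have v0 : v = 0.
  apply: (scale_cancel n2).
  lc3 (-1 : F) k29 (4 : F) (hz v) (4 * l ^+ 2 - 6 * l + 9 : F) k1.
by split=> //; move: wv; rewrite v0 scaler0 subr0.
Qed.

(** Both [N2] and [N3] are void, so [D v] and [D w] are to be found.  [EP]
becomes [w4 = 3 v + 2 w], hence [3 D v + 2 D w = 0], and the images of [EA] and
[EB] under [D] give [(3 l - 2) D v = 0], which contradicts [2 l^2 = 1] unless
[D v = 0]. *)
Lemma square_half_nu_half : 1 - 2 * l ^+ 2 = 0 -> 1 - 2 * n = 0 -> v = 0 /\ w = 0.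
Proof using Dlin n2 nl nn nl1 nlm1 nlh N1 N3 N4 EA EB EC EP E22 E13 DA DB DP.
move=> hl hn.
have hz (z : A) := scale_eq z hl.
have hy (z : A) := scale_eq z hn.
have n1 : n != 1.
  apply/eqP => h; have /eqP : (1 : F) = 0 by rc2 (-1 : F) hn (-2 : F) h.
  by rewrite oner_eq0.
have De : D e = 0 by lc3 (2 : F) N1 (-2 * n : F) (hz (D e)) (-1 : F) (hy (D e)).
have Dw4 : D w4 = 0.
  move: N4; rewrite De => H; apply: (scale_cancel nl1).
  lc3 (-2 : F) H (1 : F) (hy (D w4)) ((1 + 2 * l ^+ 2) * (l - 2 * n) : F) (hz (D w4)).
have P1 : 3 *: v + 2 *: w - w4 = 0.
  apply: (scale_cancel nl).
  lc3 (2 : F) EP (1 : F) (hz ((l + 2) *: v - 2 *: w - l *: w4))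
    (1 : F) (hy (- (2 - 2 * l) *: v + (2 * l + 2) *: w)).
have P2 : 3 *: D v + 2 *: D w = 0.
  have := congr1 D P1; rewrite !(Dadd, Dscale, Dopp) Dw4 D0 => H.
  lc1 (1 : F) H.
have A1 : (4 * (1 - l)) *: D (D v) + (1 - 2 * l) *: D v = 0.
  move: DA; rewrite De D0 => H.
  lc3 (4 : F) H (1 - 2 * l : F) (hz ((4 * n * (1 - n)) *: D v))
    (1 : F) (hy (- (4 * l) *: D (D v) + ((1 - 2 * n) * (1 - 2 * l)) *: D v)).
have B1 : 4 *: D (D v) - D v - (2 * (1 - 2 * l)) *: D w = 0.
  move: DB; rewrite De D0 => H.
  lc3 (2 : F) H (-1 : F) (hz ((1 + 2 * l) *: D v + (1 + 2 * n - 4 * l) *: D w))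
    (1 : F) (hy ((2 * l - 6 * l ^+ 2) *: D v - D w)).
have k : (3 * l - 2) *: D v = 0.
  apply: (scale_cancel n2).
  lc4 (1 : F) A1 (- (1 - l) : F) B1 (- (1 - l) * (1 - 2 * l) : F) P2
    (-3 : F) (hz (D v)).
have Dv : D v = 0 by lc2 (2 * (3 * l + 2) : F) k (9 : F) (hz (D v)).
exact: nu_ne1_elim.
Qed.

(** Only [N2] is void: [D e = D w = 0] and [EC] becomes [w = 2 v], so that
[2 D v = 0]. *)
Lemma square_half_nu_generic :
  1 - 2 * l ^+ 2 = 0 -> 1 - 2 * n != 0 -> n != 1 -> v = 0 /\ w = 0.
Proof using Dlin n2 nl nn nl1 nlh N1 N3 N4 EA EB EC E22 E13.
move=> hl hn n1; have n1' : 1 - n != 0 by rewrite subr_eq0 eq_sym.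
have hz (z : A) := scale_eq z hl.
have De : D e = 0.
  by apply: (scale_cancel n1'); lc2 (1 : F) N1 (-n : F) (hz (D e)).
have Dw : D w = 0.
  apply: (@scale_cancel _ _ ((1 - l) * (1 - 2 * n))); first by nonzero.
  move: N3; rewrite De => H.
  lc2 (1 : F) H (- l * (1 - 2 * n) : F) (hz (D w)).
have wv : w - 2 *: v = 0.
  apply: (@scale_cancel _ _ (n * (1 - 2 * l) * (1 - 2 * n))); first by nonzero.
  move: EC; rewrite De Dw => H.
  lc2 (4 : F) H (n : F) (hz (- 4 *: D v
    + (2 * (l - l ^+ 2) * (1 - 2 * n)) *: v + (2 * (l - n) * (1 - 2 * l ^+ 2)) *: w
    + (2 * (l ^+ 2 - n) * (1 - 2 * l)) *: (w - v)
    - ((1 - 2 * n) *: v + (2 * (l - n)) *: w - (1 - 2 * l) *: (w - v)))).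
have Dv : D v = 0.
  apply: (scale_cancel n2); have := congr1 D wv; rewrite !(Dadd, Dscale, Dopp) Dw D0 => H.
  lc1 (-1 : F) H.
exact: nu_ne1_elim.
Qed.

(** Both [N1] and [N2] are void.  [EA] and [N3] express [D v] and [D w] through
[D e]; the images of [EC] and [EB] under [D] give [15 D e = 0], and that of [EP]
gives [(4 - 18 l) D e = 0] if [l <> 2], hence [146 D e = 0].  Once the defects are zero,
[EC] and [EB] give [w = 2 v] and [5 v = 0], and [EP] and [E13] exclude
characteristic 5. *)
Lemma square_half_nu_one : 1 - 2 * l ^+ 2 = 0 -> n = 1 -> v = 0 /\ w = 0.
Proof using Dlin n2 nl nl1 nlh N3 N4 EA EB EC EP E13 DB DC DP.
move=> hl n1.
have hz (z : A) := scale_eq z hl.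
move: EA EB EC EP E13 DB DC DP N3 N4; rewrite n1 => HA HB HC HP G13 HB' HC' HP' M3 M4.
have De3 : D w = - D e.
  apply: (@subr0_eq _ _ _); apply: (scale_cancel nl1).
  lc2 (-1 : F) M3 (-l : F) (hz (D e + D w)).
have Dv : D v = - 3 *: D e.
  apply: (@subr0_eq _ _ _); apply: (scale_cancel nlh).
  lc1 (1 : F) HA.
have DDv : D (D v) = - 3 *: D (D e) by rewrite Dv Dscale.
have DDw : D (D w) = - D (D e) by rewrite De3 Dopp.
have C1 : (4 * l) *: D (D e) - 5 *: D e = 0.
  apply: (scale_cancel nlh); move: HC'; rewrite DDv DDw Dv De3 => H.
  lc2 (4 : F) H (1 : F) (hz (8 *: D (D e)
    - ((3 + 2 * l) * (2 * l ^+ 2) + 5 * (1 - 2 * l)) *: D e)).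
have k15 : 15 *: D e = 0.
  apply: (scale_cancel nl1); move: HB'; rewrite DDv Dv De3 => H.
  lc3 (-2 * l : F) H (-2 : F) C1 (5 - l * (15 + 2 * l) : F) (hz (D e)).
have De : D e = 0.
  (* if [l = 2] then [2 l^2 = 1] means characteristic 7 *)
  have [l2|nl2] := eqVneq (l - 2) 0.
    lc3 (1 : F) k15 (2 : F) (hz (D e)) (4 * (l + 2) : F) (scale_eq (D e) l2).
  have Dw4 : D e + D w4 = 0.
    apply: (scale_cancel nl2).
    lc2 (2 : F) M4 (- (1 + 2 * l ^+ 2) * (l - 2) : F) (hz (D e + D w4)).
  have k18 : (4 - 18 * l) *: D e = 0.
    move: HP'; rewrite Dv De3 => H.
    lc3 (2 : F) H (- (2 * l + 4) : F) (hz (D e)) (2 * l ^+ 3 : F) Dw4.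
  apply: (@scale_cancel _ _ (2 * 2)); first by nonzero.
  lc3 (10 : F) k15 (4 + 18 * l : F) k18 (- (9 * 18) : F) (hz (D e)).
have {}Dv : D v = 0 by rewrite Dv De scaler0.
have Dw : D w = 0 by rewrite De3 De oppr0.
have Dw4 : D w4 = 0.
  apply: (@scale_cancel _ _ (l ^+ 3)); first by nonzero.
  move: HP'; rewrite Dv Dw => H; lc1 (-1 : F) H.
move: HB HC G13; rewrite De Dv Dw Dw4 => HB HC G13.
have wv : w - 2 *: v = 0.
  apply: (@scale_cancel _ _ (l ^+ 2 * (1 - 2 * l))); first by nonzero.
  lc2 (-2 : F) HC (l ^+ 2 : F)
    (hz (- v + (2 * (l - 1)) *: w - (1 - 2 * l) *: (w - v))).
have k5 : 5 *: v = 0.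
  apply: (@scale_cancel _ _ (2 * (1 - l))); first by nonzero.
  lc3 (-2 : F) HB (1 : F) (hz ((4 + 2 * l) *: v + (3 - 4 * l) *: w))
    (- (3 - 4 * l) : F) wv.
have k4 : l *: w4 - (13 * l + 2) *: v = 0.
  lc3 (-2 : F) HP (1 : F) (hz (- (l + 2) *: v + 2 *: w + l *: w4)) (4 * l + 2 : F) wv.
have k13 : (10 * l - 4) *: w + (5 - 8 * l) *: w4 = 0.
  apply: (@scale_cancel _ _ (l ^+ 2)); first by nonzero.
  lc2 (-4 : F) G13 (- l ^+ 2 : F)
    (hz ((1 - 2 * l * (l - 2) - (1 + 2 * l ^+ 2) * (1 - 2 * l)) *: w
       + (2 + 2 * l * (1 - 2 * l ^+ 2) + (1 + 2 * l ^+ 2) * (1 - 2 * l)) *: w4)).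
have k41 : (41 * l - 32) *: v = 0.
  lc4 (l : F) k13 (- (l * (10 * l - 4)) : F) wv (- (5 - 8 * l) : F) k4 (-42 : F) (hz v).
have k2 : (l - 2) *: v = 0 by lc2 (1 : F) k41 (- (8 * l - 6) : F) k5.
have v0 : v = 0.
  lc3 (3 : F) k5 (4 * (l + 2) : F) k2 (2 : F) (hz v).
by split=> //; move: wv; rewrite v0 scaler0 subr0.
Qed.

(** The cases are told apart by which of [N1], [N2], [N3] have a zero
coefficient, and by whether [n = 1], where [EA] degenerates. *)
Lemma top_products_agree : v = 0 /\ w = 0.
Proof.
have [hl|nl2] := eqVneq (1 - 2 * l ^+ 2) 0.
  have [n1|n1] := eqVneq n 1; first exact: square_half_nu_one.
  have [hn|hn] := eqVneq (1 - 2 * n) 0; first exact: square_half_nu_half.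
  exact: square_half_nu_generic.
have [hln|hln] := eqVneq (1 - 2 * l * n) 0.
  have De : D e = 0.
    by apply: (scale_cancel nl1); lc2 (1 : F) N1 (-l : F) (scale_eq (D e) hln).
  have n1 : n != 1 by apply: contra_neq nlh => n1; rewrite -[RHS]hln n1 mulr1.
  have v0 : v = 0.
    apply: (@scale_cancel _ _ (2 * l ^+ 2 * n * (1 - n) * (1 - 2 * l))).
      by rewrite -subr_eq0 -oppr_eq0 opprB in n1; nonzero.
    by move: EA; rewrite De hln => H; lc1 (1 : F) H.
  by apply: nu_ne1_elim; rewrite // v0 D0.
have De2 : D e + D v = 0 by apply: (scale_cancel _ N2); apply: mulf_neq0.
have [hn|hn] := eqVneq (1 - 2 * l ^+ 2 * n) 0.
  have [hl|hl] := eqVneq (1 - 2 * l ^+ 3) 0; last exact: first_defect_generic.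
  apply: first_defect_cubic => //; apply: subr0_eq; apply: (mulfI (x := 2 * l ^+ 2)).
    by nonzero.
  by rc2 (-1 : F) hn (1 : F) hl.
have De : D e = 0 by exact: scale_cancel hn N1.
have Dv : D v = 0 by move: De2; rewrite De add0r.
by have [n1|n1] := eqVneq n 1; [apply: nu_eq1_elim | apply: nu_ne1_elim].
Qed.

End Elimination.

(** * Polarisation over small fields *)

Section Polarisation.
Variables (F : fieldType) (A : lmodType F).
Hypotheses (n2 : (2 : F) != 0) (hF3 : exists a : F, a \notin [:: 0; 1; -1]).

(** The four points [1, -1, a, -a] suffice because the constant term is zero;
adding and subtracting the values at [t] and [-t] separates the parities. *)
Lemma quartic_coefs_eq0 (g1 g2 g3 g4 : A) :
  (forall t, t *: g1 + t ^+ 2 *: g2 + t ^+ 3 *: g3 + t ^+ 4 *: g4 = 0) ->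
  [/\ g1 = 0, g2 = 0, g3 = 0 & g4 = 0].
Proof.
have [a] := hF3; rewrite !inE !negb_or => /and3P[a0 a1 am1] g0.
have na1 : 1 - a != 0 by rewrite subr_eq0 eq_sym.
have nam1 : 1 + a != 0 by rewrite addrC addr_eq0.
have g40 : g4 = 0.
  apply: (@scale_cancel _ _ (2 * a ^+ 2 * (1 - a) * (1 + a))); first by nonzero.
  lc4 (a ^+ 2) (g0 1) (a ^+ 2) (g0 (-1)) (-1 : F) (g0 a) (-1 : F) (g0 (-a)).
have g30 : g3 = 0.
  apply: (@scale_cancel _ _ (2 * a * (1 - a) * (1 + a))); first by nonzero.
  lc4 a (g0 1) (-a) (g0 (-1)) (-1 : F) (g0 a) (1 : F) (g0 (-a)).
move: g0; rewrite g30 g40 => g0.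
have g20 : g2 = 0.
  by apply: (scale_cancel n2); lc2 (1 : F) (g0 1) (1 : F) (g0 (-1)).
have g10 : g1 = 0.
  by apply: (scale_cancel n2); lc2 (1 : F) (g0 1) (-1 : F) (g0 (-1)).
by [].
Qed.

Lemma polar2 (f : A -> A -> A) :
    (forall b, is_linear (f ^~ b)) -> (forall a, is_linear (f a)) ->
    (forall y, f y y = 0) ->
  forall x y, f x y + f y x = 0.
Proof.
move=> l1 l2 f0 x y; have := f0 (1 *: x + y).
rewrite !(l1, l2, f0) => H; lc1 (1 : F) H.
Qed.

(** The coefficient of [t] at [t y + x] is the part linear in [y]; replacing [x]
by a sum in it separates the other two arguments. *)
Lemma polar3 (f : A -> A -> A -> A) :
    (forall b c, is_linear (fun a => f a b c)) ->
    (forall a c, is_linear (fun b => f a b c)) ->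
    (forall a b, is_linear (fun c => f a b c)) ->
    (forall y, f y y y = 0) ->
  forall x y z, f x y z + f x z y + f y x z + f y z x + f z x y + f z y x = 0.
Proof.
move=> l1 l2 l3 f0.
have f21 x y : f x x y + f x y x + f y x x = 0.
  have [t|//] := @quartic_coefs_eq0 (f x x y + f x y x + f y x x)
    (f x y y + f y x y + f y y x) 0 0.
  have := f0 (t *: y + x); rewrite !(l1, l2, l3) => H.
  lc3 (1 : F) H (- t ^+ 3) (f0 y) (-1 : F) (f0 x).
move=> x y z; have := f21 (1 *: x + y) z; rewrite !(l1, l2, l3) => H.
lc3 (1 : F) H (-1 : F) (f21 x z) (-1 : F) (f21 y z).
Qed.

(** Only one argument is freed: the full polarisation would multiply the
equation by six when three arguments are equal, and would be void in
characteristic 3. *)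
Lemma polar4 (f : A -> A -> A -> A -> A) :
    (forall b c d, is_linear (fun a => f a b c d)) ->
    (forall a c d, is_linear (fun b => f a b c d)) ->
    (forall a b d, is_linear (fun c => f a b c d)) ->
    (forall a b c, is_linear (fun d => f a b c d)) ->
    (forall y, f y y y y = 0) ->
  forall x y, f y x x x + f x y x x + f x x y x + f x x x y = 0.
Proof.
move=> l1 l2 l3 l4 f0 x y.
have [t|//] := @quartic_coefs_eq0 (f y x x x + f x y x x + f x x y x + f x x x y)
  (f y y x x + f y x y x + f y x x y + f x y y x + f x y x y + f x x y y)
  (f x y y y + f y x y y + f y y x y + f y y y x) 0.
have := f0 (t *: y + x); rewrite !(l1, l2, l3, l4) => H.
lc3 (1 : F) H (- t ^+ 4) (f0 y) (-1 : F) (f0 x).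
Qed.

(** Freeing the argument [u] of a five-linear form leaves a four-linear form in
the others, so that two arguments are freed in turn. *)
Definition insert5 (f : A -> A -> A -> A -> A -> A) (u a b c d : A) : A :=
  f u a b c d + f a u b c d + f a b u c d + f a b c u d + f a b c d u.

Lemma polar5 (f : A -> A -> A -> A -> A -> A) :
    (forall b c d e, is_linear (fun a => f a b c d e)) ->
    (forall a c d e, is_linear (fun b => f a b c d e)) ->
    (forall a b d e, is_linear (fun c => f a b c d e)) ->
    (forall a b c e, is_linear (fun d => f a b c d e)) ->
    (forall a b c d, is_linear (fun e => f a b c d e)) ->
    (forall y, f y y y y y = 0) ->
  forall x y u, insert5 f u y x x x + insert5 f u x y x x
    + insert5 f u x x y x + insert5 f u x x x y = 0.
Proof.
move=> l1 l2 l3 l4 l5 f0 x y u.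
apply: (@polar4 (insert5 f u)).
1-4: by move=> b c d t p q; rewrite /insert5 !(l1, l2, l3, l4, l5); module_ring.
move=> p; rewrite /insert5.
have [t|//] := @quartic_coefs_eq0
  (f u p p p p + f p u p p p + f p p u p p + f p p p u p + f p p p p u)
  (f u u p p p + f u p u p p + f u p p u p + f u p p p u + f p u u p p
   + f p u p u p + f p u p p u + f p p u u p + f p p u p u + f p p p u u)
  (f p p u u u + f p u p u u + f p u u p u + f p u u u p + f u p p u u
   + f u p u p u + f u p u u p + f u u p p u + f u u p u p + f u u u p p)
  (f p u u u u + f u p u u u + f u u p u u + f u u u p u + f u u u u p).
have := f0 (t *: u + p); rewrite !(l1, l2, l3, l4, l5) => H.
lc3 (1 : F) H (- t ^+ 5) (f0 u) (-1 : F) (f0 p).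
Qed.

End Polarisation.

(** * The forms of the identity at an idempotent *)

Section PalintropicAlgebra.
Variables (F : fieldType) (A : lmodType F) (mul : {bilinear A -> A -> A}).
Hypotheses (mulC : commutative mul) (hpal : palintropic23 mul).
Variable c : A.
Hypothesis cc : mul c c = c.

Local Notation "x ** y" := (mul x y) (at level 40, left associativity).
Local Notation L := (mul c).

Lemma prodDl x y z : (x + y) ** z = x ** z + y ** z. Proof. exact: linearDl. Qed.
Lemma prodDr x y z : z ** (x + y) = z ** x + z ** y. Proof. exact: linearDr. Qed.
Lemma prodZl k x z : (k *: x) ** z = k *: (x ** z). Proof. exact: linearZl_LR. Qed.
Lemma prodZr k x z : z ** (k *: x) = k *: (z ** x). Proof. exact: linearZr_LR. Qed.
Lemma prodNl x z : (- x) ** z = - (x ** z). Proof. exact: linearNl. Qed.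
Lemma prodNr x z : z ** (- x) = - (z ** x). Proof. exact: linearNr. Qed.
Definition prodE := (prodDl, prodDr, prodZl, prodZr, prodNl, prodNr).

(** [form2] to [form4] on the diagonal are the coefficients of [t^2] to [t^4] in
the identity at [c + t y], and [form5] is half the coefficient of [t^5]; the
arguments are kept apart to make each form linear in each of them. *)
Definition form2 (a b : A) : A :=
  2 *: L (L (a ** b) + 2 *: (a ** L b))
  + (2 *: L (L a) + L a) ** (2 *: L (L b) + L b)
  - (2 *: L (L (a ** b)) + 4 *: L (L a ** L b) + 8 *: (L a ** L (L b)) + L (a ** b)).

Definition form3 (a b d : A) : A :=
  2 *: L (a ** (b ** d))
  + 2 *: ((2 *: L (L a) + L a) ** (L (b ** d) + 2 *: (b ** L d)))
  - (4 *: L (L a ** (b ** d)) + 4 *: (L a ** L (b ** d))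
     + 8 *: (L a ** (L b ** L d)) + 4 *: (L (L a) ** (b ** d))).

Definition form4 (a b d e : A) : A :=
  2 *: ((2 *: L (L a) + L a) ** (b ** (d ** e)))
  + (L (a ** b) + 2 *: (a ** L b)) ** (L (d ** e) + 2 *: (d ** L e))
  - (L ((a ** b) ** (d ** e)) + 8 *: (L a ** (L b ** (d ** e)))
     + 2 *: ((a ** b) ** L (d ** e)) + 4 *: ((a ** b) ** (L d ** L e))).

Definition form5 (a b d e h : A) : A :=
  (L (a ** b) + 2 *: (a ** L b)) ** (d ** (e ** h))
  - (L a ** ((b ** d) ** (e ** h)) + 2 *: ((a ** b) ** (L d ** (e ** h)))).

(** With [z1, z2, z3] the coefficients of the cube of [c + t y], [u, v] those of
its square and [w1, w2, w3] those of the square of its square, the coefficients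
of the identity are products of pairs; that of [t] vanishes because
[2 L z1 = L w1 + L u]. *)
Lemma palintropic_expansion t y :
  t ^+ 2 *: form2 y y + t ^+ 3 *: form3 y y y
  + t ^+ 4 *: form4 y y y y + (2 * t ^+ 5) *: form5 y y y y y = 0.
Proof.
(* opaque names, lest the distributivity rules unfold them *)
have [u uE] : {u | u = 2 *: L y} by eexists.
have [v vE] : {v | v = y ** y} by eexists.
have [z1 z1E] : {z1 | z1 = L u + L y} by eexists.
have [z2 z2E] : {z2 | z2 = L v + y ** u} by eexists.
have [z3 z3E] : {z3 | z3 = y ** v} by eexists.
have [w1 w1E] : {w1 | w1 = 2 *: L u} by eexists.
have [w2 w2E] : {w2 | w2 = 2 *: L v + u ** u} by eexists.
have [w3 w3E] : {w3 | w3 = 2 *: (u ** v)} by eexists.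
have EX : (c + t *: y) ** (c + t *: y) = c + t *: u + t ^+ 2 *: v.
  by rewrite !prodE cc (mulC y c) uE vE; module_ring.
have EZ : (c + t *: y) ** (c + t *: u + t ^+ 2 *: v)
    = c + t *: z1 + t ^+ 2 *: z2 + t ^+ 3 *: z3.
  by rewrite !prodE cc (mulC y c) z1E z2E z3E; module_ring.
have EW : (c + t *: u + t ^+ 2 *: v) ** (c + t *: u + t ^+ 2 *: v)
    = c + t *: w1 + t ^+ 2 *: w2 + t ^+ 3 *: w3 + t ^+ 4 *: (v ** v).
  by rewrite !prodE cc (mulC u c) (mulC v c) (mulC v u) w1E w2E w3E; module_ring.
have := hpal (c + t *: y); rewrite /sq /cube EX EZ EW.
have P6 := hpal y; rewrite /sq /cube -vE -z3E in P6.
have E2 : form2 y y = 2 *: L z2 + z1 ** z1 - (L w2 + u ** w1 + L v).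
  rewrite /form2 ?z2E ?z1E ?w2E ?w1E ?uE ?vE !prodE; module_ring.
have E3 : form3 y y y = 2 *: L z3 + 2 *: (z1 ** z2) - (L w3 + u ** w2 + w1 ** v).
  rewrite /form3 ?z3E ?z2E ?z1E ?w3E ?w2E ?w1E ?uE ?vE !prodE; module_ring.
have E4 : form4 y y y y = 2 *: (z1 ** z3) + z2 ** z2
    - (L (v ** v) + u ** w3 + v ** w2).
  rewrite /form4 ?z3E ?z2E ?z1E ?w3E ?w2E ?w1E ?uE ?vE !prodE; module_ring.
have E5 : 2 *: form5 y y y y y = 2 *: (z2 ** z3) - (u ** (v ** v) + v ** w3).
  rewrite /form5 ?z3E ?z2E ?z1E ?w3E ?w2E ?w1E ?uE ?vE !prodE; module_ring.
have Lz1 : 2 *: L z1 = L w1 + L u.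
  rewrite z1E w1E uE !prodE; module_ring.
rewrite !prodE cc.
rewrite (mulC z1 c) (mulC z2 c) (mulC z3 c) (mulC z2 z1) (mulC z3 z1) (mulC z3 z2).
rewrite (mulC u c) (mulC v c) (mulC v w1) E2 E3 E4 => H.
lc4 (1 : F) H (- t) Lz1 (t ^+ 5) E5 (- t ^+ 6) P6.
Qed.

Hypotheses (n2 : (2 : F) != 0) (hF3 : exists a : F, a \notin [:: 0; 1; -1]).

Lemma forms_eq0 y :
  [/\ form2 y y = 0, form3 y y y = 0, form4 y y y y = 0 & form5 y y y y y = 0].
Proof.
have [t|g2 g3 g4 g5] := quartic_coefs_eq0 n2 hF3 (g1 := form2 y y) (g2 := form3 y y y)
  (g3 := form4 y y y y) (g4 := 2 *: form5 y y y y y).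
  have [->|t0] := eqVneq t 0; first by module_ring.
  apply: (scale_cancel t0); lc1 (1 : F) (palintropic_expansion t y).
by split=> //; apply: scale_cancel g5.
Qed.

Lemma form2_sym x y : form2 x y + form2 y x = 0.
Proof.
apply: polar2 => [b t p q|a t p q|z]; last by case: (forms_eq0 z).
all: by rewrite /form2 !prodE; module_ring.
Qed.

Lemma form3_sym x y z : form3 x y z + form3 x z y + form3 y x z
  + form3 y z x + form3 z x y + form3 z y x = 0.
Proof.
apply: (polar3 n2 hF3) => [b d t p q|a d t p q|a b t p q|r]; last by case: (forms_eq0 r).
all: by rewrite /form3 !prodE; module_ring.
Qed.

Lemma form4_sym x y :
  form4 y x x x + form4 x y x x + form4 x x y x + form4 x x x y = 0.
Proof.
apply: (polar4 n2 hF3); last by move=> r; case: (forms_eq0 r).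
all: by move=> ? ? ? t p q; rewrite /form4 !prodE; module_ring.
Qed.

Lemma form5_sym x y u : insert5 form5 u y x x x + insert5 form5 u x y x x
    + insert5 form5 u x x y x + insert5 form5 u x x x y = 0.
Proof.
apply: (polar5 n2 hF3); last by move=> r; case: (forms_eq0 r).
all: by move=> ? ? ? ? t p q; rewrite /form5 !prodE; module_ring.
Qed.

(** * Products of eigenvectors *)

(** On eigenvectors the polarised [form2] is, up to sign,
[2 (1 - 2 a) (1 - 2 b) (L(pq) - a b pq)]. *)
Lemma weight_mul a b p q : L p = a *: p -> L q = b *: q ->
  1 - 2 * a != 0 -> 1 - 2 * b != 0 -> L (p ** q) = (a * b) *: (p ** q).
Proof.
move=> Lp Lq na nb; apply: subr0_eq.
apply: (@scale_cancel _ _ (2 * (1 - 2 * a) * (1 - 2 * b))); first by nonzero.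
have := form2_sym p q.
rewrite /form2 (mulC q p) !(Lp, Lq, prodE) (mulC q p) => H.
lc1 (-1 : F) H.
Qed.

(** For [p] in the kernel of [L], the polarised [form2] at [p] and any [y]
reduces to [- 2 L(p (y - 2 L y))]. *)
Lemma kernel_mul p y : L p = 0 -> L (p ** (y - 2 *: L y)) = 0.
Proof.
move=> Lp; apply: (scale_cancel n2).
have := form2_sym p y.
have m0l z : 0 ** z = 0 by exact: linear0l.
have m0r z : z ** 0 = 0 by exact: linear0r.
rewrite /form2 (mulC y p) Lp !(Lp, m0r, m0l, prodE) => H.
lc1 (-1 : F) H.
Qed.

(** In this lemma and the next two, the inner products are known multiples of
known eigenvectors; only the outermost products, and [L] applied to them, remain
as unknowns. *)
Lemma form3_weight a b d p q r s : L p = a *: p -> L q = b *: q -> L r = d *: r ->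
  q ** r = (b * d) *: s -> L s = (b * d) *: s ->
  form3 p q r = (2 * b * d * (1 - 2 * a)) *: L (p ** s)
   + (b * d * (2 * (2 * a ^+ 2 + a) * (b * d + 2 * d)
        - 12 * a * b * d - 4 * a ^+ 2)) *: (p ** s).
Proof.
move=> Lp Lq Lr qr Ls.
rewrite /form3 !(Lp, Lq, Lr, qr, Ls, prodE); module_ring.
Qed.

Lemma form4_weight a b d e p q r s pq rs qrs :
  L p = a *: p -> L q = b *: q -> L r = d *: r -> L s = e *: s ->
  p ** q = (a * b) *: pq -> L pq = (a * b) *: pq ->
  r ** s = (d * e) *: rs -> L rs = (d * e) *: rs ->
  q ** rs = (b * d * e) *: qrs ->
  form4 p q r s =
    (2 * b * (d * e) ^+ 2 * (2 * a ^+ 2 + a - 4 * a * b)) *: (p ** qrs)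
    + (a * b * d * e * ((a * b + 2 * b) * (d * e + 2 * e) - 6 * d * e)) *: (pq ** rs)
    - (a * b * d * e) *: L (pq ** rs).
Proof.
move=> Lp Lq Lr Ls Epq Lpq Ers Lrs Eqrs.
rewrite /form4 !(Lp, Lq, Lr, Ls, Epq, Lpq, Ers, Lrs, Eqrs, prodE); module_ring.
Qed.

Lemma form5_weight a b d e h p q r s t pq qr st rst qrst :
  L p = a *: p -> L q = b *: q -> L r = d *: r ->
  p ** q = (a * b) *: pq -> L pq = (a * b) *: pq ->
  q ** r = (b * d) *: qr -> s ** t = (e * h) *: st ->
  r ** st = (d * e * h) *: rst -> qr ** st = (b * d * e * h) *: qrst ->
  form5 p q r s t =
    (a * b * d * (e * h) ^+ 2 * (a * b + 2 * b - 2 * d)) *: (pq ** rst)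
    - (a * (b * d * e * h) ^+ 2) *: (p ** qrst).
Proof.
move=> Lp Lq Lr Epq Lpq Eqr Est Erst Eqrst.
rewrite /form5 !(Lp, Lq, Lr, Epq, Lpq, Eqr, Est, Erst, Eqrst, prodE); module_ring.
Qed.

(** * Powers of an eigenvector *)

Section TwistedPowers.
Variables (l : F) (x : A).
Hypotheses (nl : l != 0) (nl1 : 1 - l != 0) (nlm1 : 1 + l != 0) (nlh : 1 - 2 * l != 0).
Hypothesis Lx : L x = l *: x.

(** The factor is chosen so that [tpow n] is the [n]-fold associative power of
[x] when the product is [phi(x * y)] with [phi(x) = l x]. *)
Fixpoint tpow (n : nat) : A :=
  match n with
  | 0 => 0
  | m.+1 => if m is 0 then x else l ^- n *: (x ** tpow m)
  end.

Definition weighted (n : nat) : Prop :=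
  (forall i, (0 < i <= n)%N -> L (tpow i) = l ^+ i *: tpow i) /\
  (forall i j, (0 < i)%N -> (0 < j)%N -> (i + j <= n)%N ->
     tpow i ** tpow j = l ^+ (i + j) *: tpow (i + j)).

Section Level.
Variable N : nat.
Hypotheses (N2 : (1 < N)%N) (wN : weighted N.-1).

Definition topprod (i : nat) : A := tpow i ** tpow (N - i).
Definition defect (z : A) : A := L z - l ^+ N *: z.
Local Notation E := topprod.
Local Notation D := defect.

Let Lt i : (0 < i < N)%N -> L (tpow i) = l ^+ i *: tpow i.
Proof. by move=> ?; apply: (proj1 wN); lia. Qed.

Let Mt i j : (0 < i)%N -> (0 < j)%N -> (i + j < N)%N ->
  tpow i ** tpow j = l ^+ (i + j) *: tpow (i + j).
Proof. by move=> ? ? ?; apply: (proj2 wN); lia. Qed.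

Lemma topprodC i : (i <= N)%N -> E i = E (N - i).
Proof. by move=> ?; rewrite /E subKn // mulC. Qed.

Lemma defect_linear : is_linear D.
Proof. by move=> t p q; rewrite /D !prodE; module_ring. Qed.

Lemma defectE z : L z = D z + l ^+ N *: z.
Proof. by rewrite /D; module_ring. Qed.

Lemma defect_topprod i : (0 < i < N)%N ->
  ((1 - 2 * l ^+ i) * (1 - 2 * l ^+ (N - i))) *: D (E i) = 0.
Proof.
move=> iN.
have [->|ni] := eqVneq (1 - 2 * l ^+ i) 0; first by rewrite mul0r scale0r.
have [->|nj] := eqVneq (1 - 2 * l ^+ (N - i)) 0; first by rewrite mulr0 scale0r.
have := weight_mul (Lt iN) (Lt (_ : (0 < N - i < N)%N)) ni nj.
rewrite -exprD subnKC; last lia.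
by move=> H; rewrite /D H ?subrr ?scaler0 //; lia.
Qed.

Lemma form3_tpow i j k : (0 < i)%N -> (0 < j)%N -> (0 < k)%N -> (i + j + k)%N = N ->
  form3 (tpow i) (tpow j) (tpow k) =
    (2 * l ^+ j * l ^+ k * (1 - 2 * l ^+ i)) *: L (E i)
   + (l ^+ j * l ^+ k * (2 * (2 * (l ^+ i) ^+ 2 + l ^+ i) * (l ^+ j * l ^+ k + 2 * l ^+ k)
        - 12 * l ^+ i * l ^+ j * l ^+ k - 4 * (l ^+ i) ^+ 2)) *: E i.
Proof.
move=> i0 j0 k0 ijk; rewrite /E (_ : N - i = j + k)%N; last lia.
by apply: form3_weight; rewrite -?exprD; (apply: Lt || apply: Mt); lia.
Qed.

Lemma form4_tpow i j k m : (0 < i)%N -> (0 < j)%N -> (0 < k)%N -> (0 < m)%N ->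
  (i + j + k + m)%N = N ->
  form4 (tpow i) (tpow j) (tpow k) (tpow m) =
    (2 * l ^+ j * (l ^+ k * l ^+ m) ^+ 2 *
      (2 * (l ^+ i) ^+ 2 + l ^+ i - 4 * l ^+ i * l ^+ j)) *: E i
    + (l ^+ i * l ^+ j * l ^+ k * l ^+ m * ((l ^+ i * l ^+ j + 2 * l ^+ j)
        * (l ^+ k * l ^+ m + 2 * l ^+ m) - 6 * l ^+ k * l ^+ m)) *: E (i + j)
    - (l ^+ i * l ^+ j * l ^+ k * l ^+ m) *: L (E (i + j)).
Proof.
move=> i0 j0 k0 m0 ijkm; rewrite /E (_ : N - i = j + (k + m))%N; last lia.
rewrite (_ : N - (i + j) = k + m)%N; last lia.
by apply: form4_weight; rewrite -?exprD -?addnA; (apply: Lt || apply: Mt); lia.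
Qed.

Lemma form5_tpow i j k m n : (0 < i)%N -> (0 < j)%N -> (0 < k)%N -> (0 < m)%N ->
  (0 < n)%N -> (i + j + k + m + n)%N = N ->
  form5 (tpow i) (tpow j) (tpow k) (tpow m) (tpow n) =
    (l ^+ i * l ^+ j * l ^+ k * (l ^+ m * l ^+ n) ^+ 2
      * (l ^+ i * l ^+ j + 2 * l ^+ j - 2 * l ^+ k)) *: E (i + j)
    - (l ^+ i * (l ^+ j * l ^+ k * l ^+ m * l ^+ n) ^+ 2) *: E i.
Proof.
move=> i0 j0 k0 m0 n0 ijkmn; rewrite /E (_ : N - i = (j + k) + (m + n))%N; last lia.
rewrite (_ : N - (i + j) = k + (m + n))%N; last lia.
apply: form5_weight; rewrite -?exprD -?addnA; try by (apply: Lt || apply: Mt); lia.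
by rewrite addnA; apply: Mt; lia.
Qed.

(** The cubic form in degrees [i, j, k], after writing [L = D + l^N].  Only
differences occur on the right: in the model all [E i] are equal and have no
defect. *)
Lemma level3 i j k : (0 < i)%N -> (0 < j)%N -> (0 < k)%N -> (i + j + k)%N = N ->
  let a := l ^+ i in let b := l ^+ j in let d := l ^+ k in
  (b * d * (1 - 2 * a)) *: D (E i) + (a * d * (1 - 2 * b)) *: D (E j)
   + (a * b * (1 - 2 * d)) *: D (E k)
  = (a * b * d) *: (((a - b) * (1 - 2 * d)) *: (E i - E j)
      + ((a - d) * (1 - 2 * b)) *: (E i - E k) + ((b - d) * (1 - 2 * a)) *: (E j - E k)).
Proof.
move=> i0 j0 k0 ijk a b d; have EN : l ^+ N = a * b * d by rewrite -ijk !exprD.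
apply: subr0_eq; apply: (@scale_cancel _ _ (2 * 2)); first by nonzero.
have := form3_sym (tpow i) (tpow j) (tpow k).
rewrite !form3_tpow ?defectE ?EN -/a -/b -/d //; try by clear -ijk; lia.
by move=> H; lc1 (1 : F) H.
Qed.

(** The quartic form in degrees [1, 1, 1, m].  It involves [L] only through
products of two powers of degree at least two, here only [E 2]. *)
Lemma level4 m : (0 < m)%N -> (m + 3)%N = N -> let n := l ^+ m in
  2 *: D (E 2) = (2 * l * (3 * l * n + l ^+ 2 - n - l)) *: (E 2 - E 1)
    + (l ^+ 2 * (2 * n + 1 - 4 * l)) *: (E 3 - E 1).
Proof.
move=> m0 mN n; have EN : l ^+ N = n * l ^+ 3 by rewrite -mN exprD.
have nn : n != 0 by rewrite expf_neq0.
apply: subr0_eq; apply: (@scale_cancel _ _ (2 * l ^+ 3 * n)).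
  by rewrite !mulf_neq0 ?expf_neq0.
have := form4_sym (tpow 1) (tpow m).
rewrite !form4_tpow //; try by clear -mN; lia.
rewrite [E m]topprodC ?[E (m + 1)]topprodC; try lia.
have -> : (N - m = 3)%N by lia.
have -> : (N - (m + 1) = 2)%N by lia.
have -> : E (1 + m) = E 2 by rewrite topprodC; [congr E; lia | lia].
rewrite ?addn1 !defectE EN expr1 -/n => H.
lc1 (-1 : F) H.
Qed.

(** The quintic form in degrees [1, 1, 1, k, m].  No term of it has [L] as its
outermost operator, hence there is no defect, and the coefficient of [E (k + 3)]
never vanishes. *)
Lemma level5 k m : (0 < k)%N -> (0 < m)%N -> (k + m + 3)%N = N ->
  let b := l ^+ k in let d := l ^+ m in
  ((l + 2) * (b * d + l * d + l * b) - 6 * b * d) *: E 2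
  + ((l * b + b + l) * (2 * d + l) - 6 * l * d) *: E (k + 1)
  + ((l * d + d + l) * (2 * b + l) - 6 * l * b) *: E (k + 2)
  + (l * (b * d + d + b) - 2 * l ^+ 2) *: E 3
  = (6 * l * b * d) *: E 1 + (2 * l ^+ 2 * d) *: E k + (2 * l ^+ 2 * b) *: E (k + 3).
Proof.
move=> k0 m0 kmN b d.
have nb : b != 0 by rewrite expf_neq0.
have nd : d != 0 by rewrite expf_neq0.
apply: subr0_eq; apply: (@scale_cancel _ _ (2 * l ^+ 4 * b * d)).
  by rewrite !mulf_neq0 ?expf_neq0.
have := form5_sym (tpow 1) (tpow k) (tpow m).
rewrite /insert5 !form5_tpow //; try by clear -kmN; lia.
have Em : E m = E (k + 3) by rewrite topprodC; [congr E; lia | lia].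
have Em1 : E (m + 1) = E (k + 2) by rewrite topprodC; [congr E; lia | lia].
have E1m : E (1 + m) = E (k + 2) by rewrite addnC.
have Ekm : E (k + m) = E 3 by rewrite topprodC; [congr E; lia | lia].
have Emk : E (m + k) = E 3 by rewrite addnC.
have E1k : E (1 + k) = E (k + 1) by rewrite addnC.
have E11 : E (1 + 1) = E 2 by [].
rewrite E11 Em Em1 E1m Ekm Emk E1k expr1 -/b -/d => H.
lc1 (1 : F) H.
Qed.

Lemma defect_sub i : D (E 1) + D (E i - E 1) = D (E i).
Proof. by rewrite /D !prodE; module_ring. Qed.

Lemma topprod_low : (4 < N)%N -> E 2 = E 1 /\ E 3 = E 1.
Proof.
move=> N4; pose m := (N - 4)%N; have m0 : (0 < m)%N by rewrite /m; lia.
pose q := l ^+ m; have nq : q != 0 by rewrite expf_neq0.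
have lN k j : (k + j = 4)%N -> l ^+ (N - k) = l ^+ j * q.
  by move=> kj; rewrite -exprD; congr (l ^+ _); rewrite /m; lia.
have lm1 : l ^+ m.+1 = l * q by rewrite exprS.
have lm2 : l ^+ m.+2 = l ^+ 2 * q by rewrite !exprS expr0 mulr1 mulrA.
have Em : E m = E 4 by rewrite topprodC; [congr E; rewrite /m; lia | rewrite /m; lia].
have Em1 : E m.+1 = E 3 by rewrite topprodC; [congr E; rewrite /m; lia | rewrite /m; lia].
have Em2 : E m.+2 = E 2 by rewrite topprodC; [congr E; rewrite /m; lia | rewrite /m; lia].
suff [/subr0_eq -> /subr0_eq ->] : E 2 - E 1 = 0 /\ E 3 - E 1 = 0 by [].
apply: (@top_products_agree _ _ D defect_linear l (l * q)
  (E 1) (E 2 - E 1) (E 3 - E 1) (E 4 - E 1)) => //.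
- exact: mulf_neq0.
- apply: (scale_cancel nlh).
  have := @defect_topprod 1 ltac:(lia); rewrite (lN 1 3) // => H; lc1 (1 : F) H.
- rewrite defect_sub.
  have := @defect_topprod 2 ltac:(lia); rewrite (lN 2 2) // => H; lc1 (1 : F) H.
- rewrite defect_sub.
  have := @defect_topprod 3 ltac:(lia); rewrite (lN 3 1) // => H; lc1 (1 : F) H.
- rewrite defect_sub.
  have := @defect_topprod 4 ltac:(lia); rewrite (lN 4 0) // => H; lc1 l H.
- rewrite defect_sub; apply: subr0_eq; apply: (@scale_cancel _ _ (l ^+ 2)); first by nonzero.
  have := @level3 1 1 m.+2 isT isT isT ltac:(rewrite /m; lia).
  rewrite /= lm2 Em2 => H; lc1 (1 : F) H.
- rewrite defect_sub.
  have := @level4 m.+1 isT ltac:(rewrite /m; lia).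
  rewrite /= lm1 => H; lc1 (1 : F) H.
- rewrite !defect_sub; apply: subr0_eq; apply: (scale_cancel nl).
  have := @level3 1 2 m.+1 isT isT isT ltac:(rewrite /m; lia).
  rewrite /= lm1 Em1 => H; lc1 (1 : F) H.
- apply: subr0_eq; apply: (scale_cancel n2).
  have := @level5 1 m isT m0 ltac:(rewrite /m; lia).
  rewrite /= -/q !add1n => H; lc1 (1 : F) H.
- rewrite !defect_sub; apply: subr0_eq; apply: (scale_cancel nl).
  have := @level3 2 2 m isT isT m0 ltac:(rewrite /m; lia).
  rewrite /= -/q Em => H; lc1 (1 : F) H.
- rewrite !defect_sub.
  have := @level3 1 3 m isT isT m0 ltac:(rewrite /m; lia).
  rewrite /= -/q Em => H; lc1 (1 : F) H.
Qed.

(** In degree four there is no quintic relation, but [E 3 = E 1] by symmetry, and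
the relations in degrees [1, 1, 2] and [1, 1, 1, 1] suffice. *)
Lemma topprod_low4 : N = 4%N -> E 2 = E 1.
Proof.
move=> N4; have E31 : E 3 = E 1 by rewrite topprodC N4.
have HB : 2 *: D (E 2) = (2 * l * (4 * l ^+ 2 - 2 * l)) *: (E 2 - E 1).
  by have := @level4 1 isT ltac:(lia); rewrite E31 /= expr1 => H; lc1 (1 : F) H.
have HA : (2 * l * (1 - 2 * l)) *: D (E 1) + (1 - 2 * l ^+ 2) *: D (E 2)
    = - (2 * l ^+ 3 * (1 - l) * (1 - 2 * l)) *: (E 2 - E 1).
  apply: subr0_eq; apply: (@scale_cancel _ _ (l ^+ 2)); first by nonzero.
  have := @level3 1 1 2 isT isT isT ltac:(lia).
  by rewrite /= => H; lc1 (1 : F) H.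
have M1 : (1 - 2 * l ^+ 3) *: D (E 1) = 0.
  apply: (scale_cancel nlh).
  by have := @defect_topprod 1 ltac:(lia); rewrite N4 => H; lc1 (1 : F) H.
have M2 : (1 - 2 * l ^+ 2) ^+ 2 *: D (E 2) = 0.
  by have := @defect_topprod 2 ltac:(lia); rewrite N4 => H; lc1 (1 : F) H.
apply: subr0_eq.
have [hl|nl2] := eqVneq (1 - 2 * l ^+ 2) 0; last first.
  have De2 : D (E 2) = 0 by apply: scale_cancel M2; nonzero.
  apply: (@scale_cancel _ _ (2 * 2 * l ^+ 2 * (1 - 2 * l))); first by nonzero.
  by move: HB; rewrite De2 => H; lc1 (1 : F) H.
have De1 : D (E 1) = 0.
  by apply: (scale_cancel nl1); lc2 (1 : F) M1 (- l : F) (scale_eq (D (E 1)) hl).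
apply: (@scale_cancel _ _ (2 * l ^+ 3 * (1 - l) * (1 - 2 * l))); first by nonzero.
by move: HA; rewrite De1 hl => H; lc1 (1 : F) H.
Qed.

Lemma topprod_const i : (0 < i < N)%N -> E i = E 1.
Proof.
elim/ltn_ind: i => i IH iN.
have [N4|N4] := ltnP 4 N; last first.
  have [i1|i1] := leqP i 1; first by congr E; lia.
  have [->|iN1] := eqVneq i N.-1.
    by rewrite topprodC; [congr E; lia | lia].
  by rewrite -(topprod_low4 _); [congr E; lia | lia].
have [E2 E3] := topprod_low N4.
have [i3|i3] := leqP i 3.
  by move: iN i3 {IH}; case: i => [|[|[|[|i]]]] //.
pose k := (i - 3)%N; pose m := (N - i)%N.
have k0 : (0 < k)%N by rewrite /k; lia.
have m0 : (0 < m)%N by rewrite /m; lia.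
have kmN : (k + m + 3)%N = N by rewrite /k /m; lia.
have ik : i = (k + 3)%N by rewrite /k; lia.
have := level5 k0 m0 kmN.
rewrite (IH k) ?(IH (k + 1)%N) ?(IH (k + 2)%N) ?E2 ?E3 -?ik /=; try by rewrite /k; lia.
have nb : l ^+ k != 0 by rewrite expf_neq0.
move: nb; move: (l ^+ k) (l ^+ m) => b d nb H.
apply: subr0_eq; apply: (@scale_cancel _ _ (2 * l ^+ 2 * b)); first by nonzero.
lc1 (-1 : F) H.
Qed.

(** With all [E i] equal the right-hand side of [level4] is zero.  In degree
three the form [form3] is used at one vector, because [level3] at three equal
degrees carries a factor 3. *)
Lemma topprod_weight : D (E 1) = 0.
Proof.
have [N3|N3] := leqP N 3; last first.
  have HB := @level4 (N - 3) ltac:(lia) ltac:(lia).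
  have E21 : E 2 = E 1 by apply: topprod_const; lia.
  have E31 : E 3 = E 1 by apply: topprod_const; lia.
  move: HB; rewrite E21 E31 => H.
  by apply: (scale_cancel n2); lc1 (1 : F) H.
have [N2'|N2'] := leqP N 2.
  have := @defect_topprod 1 ltac:(lia); apply: scale_cancel.
  by rewrite (_ : N - 1 = 1)%N; [rewrite expr1 mulf_neq0 | lia].
have [_ h3 _ _] := forms_eq0 (tpow 1).
apply: (@scale_cancel _ _ (2 * l ^+ 2 * (1 - 2 * l))); first by nonzero.
move: h3; rewrite form3_tpow ?defectE ?expr1 //; last lia.
have -> : l ^+ N = l ^+ 3 by congr (_ ^+ _); lia.
by move=> H; lc1 (1 : F) H.
Qed.

End Level.

(** The induction on the degree: [tpow N] is a multiple of [E 1] by definition,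
so the equality of all [E i] is the product rule in degree [N], and the vanishing
of the defect of [E 1] is the eigenvalue equation. *)
Lemma weighted_all n : weighted n.
Proof.
elim: n => [|n IH]; first by split=> [i|i j]; lia.
have [->|n0] := posnP n.
  split=> [i i1|i j]; last lia.
  by have -> : i = 1%N by lia.
have N2 : (1 < n.+1)%N by lia.
have top i j : (0 < i)%N -> (0 < j)%N -> (i + j = n.+1)%N ->
    tpow i ** tpow j = l ^+ n.+1 *: tpow n.+1.
  move=> i0 j0 ij; have := topprod_const N2 IH (i := i) ltac:(lia).
  rewrite /topprod (_ : n.+1 - i = j)%N; last lia.
  rewrite subSS subn0 => ->; move: n0; case: (n) => // k _.
  by rewrite /= scalerA mulfV ?scale1r // expf_neq0.
have topL : L (tpow n.+1) = l ^+ n.+1 *: tpow n.+1.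
  have := topprod_weight N2 IH; rewrite /topprod subSS subn0 top; try lia.
  rewrite /defect prodZr => H; apply: subr0_eq; apply: scale_cancel (_ : l ^+ n.+1 != 0) _.
    by rewrite expf_neq0.
  by lc1 (1 : F) H.
split=> [i iN|i j i0 j0 ij].
  have [->|ni] := eqVneq i n.+1; first exact: topL.
  by apply: IH.1; lia.
have [e|ne] := eqVneq (i + j)%N n.+1; first by rewrite e; apply: top.
by apply: IH.2; lia.
Qed.

Lemma napow_tpow d : exists s, napow mul x d = s *: tpow (nadeg d).
Proof.
have deg0 d' : (0 < nadeg d')%N by elim: d' => //= d1 h1 d2 _; lia.
elim: d => [|d1 [s1 e1] d2 [s2 e2]] /=; first by exists 1; rewrite scale1r.
have [_ wM] := weighted_all (nadeg d1 + nadeg d2).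
exists (s1 * s2 * l ^+ (nadeg d1 + nadeg d2)).
by rewrite e1 e2 !prodE wM //; module_ring.
Qed.

Lemma napow_weight d : L (napow mul x d) = l ^+ nadeg d *: napow mul x d.
Proof.
have deg0 d' : (0 < nadeg d')%N by elim: d' => //= d1 h1 d2 _; lia.
have [s ->] := napow_tpow d; have [wL _] := weighted_all (nadeg d).
by rewrite !prodE wL ?deg0 ?leqnn //; module_ring.
Qed.

End TwistedPowers.

(** * Peirce subspaces *)

Lemma peirceP (a : F) (x : A) : reflect (mul c x = a *: x) (x \in peirce mul c a).
Proof. by rewrite inE /Lop subr_eq0; apply: eqP. Qed.

Lemma ne_half (a : F) : (a != 2^-1) = (1 - 2 * a != 0).
Proof.
congr (~~ _); apply/eqP/eqP => [->|h]; first by rewrite mulfV ?subrr.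
by apply: (mulfI n2); rewrite mulfV // -(subr0_eq h).
Qed.

Lemma peirce_submod (a : F) : submod_closed (peirce mul c a).
Proof.
split=> [|k x y /peirceP cx /peirceP cy]; apply/peirceP.
  by rewrite linear0r scaler0.
by rewrite linearDr linearZr_LR cx cy; module_ring.
Qed.

Lemma peirce_mul (a b : F) x y : a != 2^-1 -> b != 2^-1 ->
  x \in peirce mul c a -> y \in peirce mul c b -> mul x y \in peirce mul c (a * b).
Proof.
rewrite !ne_half => na nb /peirceP cx /peirceP cy; apply/peirceP.
exact: weight_mul.
Qed.

Lemma peirce_prod_span (a b : F) z : a != 2^-1 -> b != 2^-1 ->
  prod_span mul (peirce mul c a) (peirce mul c b) z -> z \in peirce mul c (a * b).
Proof.
move=> na nb [s sUV ->]; apply/peirceP; rewrite linear_sumr scaler_sumr.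
rewrite big_seq [RHS]big_seq; apply: eq_bigr => t /sUV[xa yb].
have /peirceP cxy := peirce_mul na nb xa yb.
by rewrite linearZr_LR cxy !scalerA mulrC.
Qed.

Lemma peirce_subalgebra (a : F) : a != 2^-1 -> a * a = a -> subalgebra mul (peirce mul c a).
Proof.
move=> na aa; split; first exact: peirce_submod.
by move=> x y xa ya; rewrite -aa; apply: peirce_mul.
Qed.

Lemma peirce0_ideal : nonsingular mul c -> ideal mul (peirce mul c 0).
Proof.
case=> inv _ invK; split; first exact: peirce_submod.
move=> a x /peirceP; rewrite scale0r => cx; apply/peirceP.
rewrite scale0r (mulC a x) -[a]invK; exact: kernel_mul.
Qed.

(** If no power of [a] below the degree is [1/2], the product rule applies at
each multiplication.  Otherwise [a] is neither [0] nor [1] nor [-1], since the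
powers of these could only equal [1/2] if [a] itself did, and the structure of
the powers of [x] applies. *)
Lemma napow_peirce (a : F) x d : x \in peirce mul c a -> a != 2^-1 ->
  mul c (napow mul x d) = a ^+ nadeg d *: napow mul x d.
Proof.
rewrite ne_half => /peirceP cx nah.
have [/existsP[m /eqP am]|] := boolP [exists m : 'I_(nadeg d), a ^+ m == 2^-1].
  have na : a != 0.
    apply/eqP => a0; move: am; rewrite a0 expr0n => h.
    have : (2 : F) * (m == 0 :> nat)%:R = 1 by rewrite h mulfV.
    case: (m == 0 :> nat) => /eqP; last by rewrite mulr0 eq_sym oner_eq0.
    by rewrite mulr1 -subr_eq0 (_ : 2 - 1 = 1) ?oner_eq0 //; ring.
  have h1 : 2 * a ^+ m = 1 by rewrite am mulfV.
  have na1 : 1 - a != 0.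
    apply/eqP => /subr0_eq a1; have /eqP : (1 : F) = 0 by
      move: h1; rewrite -a1 expr1n => h1; rc1 (1 : F) h1.
    by rewrite oner_eq0.
  have nam1 : 1 + a != 0.
    apply/eqP => ha; have a1 : a = -1 by rc1 (1 : F) ha.
    move: h1; rewrite a1 -signr_odd; case: (odd m); rewrite ?expr0 ?expr1 => h1.
      by case/eqP: nah; rewrite a1; rc1 (-1 : F) h1.
    have /eqP : (1 : F) = 0 by rc1 (1 : F) h1.
    by rewrite oner_eq0.
  exact: (napow_weight na na1 nam1 nah cx).
rewrite negb_exists => /forallP nhalf.
have {}nhalf k : (k < nadeg d)%N -> a ^+ k != 2^-1.
  by move=> lt_k; apply: (nhalf (Ordinal lt_k)).
have deg0 d' : (0 < nadeg d')%N by elim: d' => //= d1 h1 d2 _; lia.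
elim: d nhalf => [|d1 IH1 d2 IH2] /= nhalf; first by rewrite expr1.
rewrite exprD; apply: weight_mul; rewrite -?ne_half.
- by apply: IH1 => k ?; apply: nhalf; lia.
- by apply: IH2 => k ?; apply: nhalf; lia.
- by apply: nhalf; have := deg0 d2; lia.
- by apply: nhalf; have := deg0 d1; lia.
Qed.

End PalintropicAlgebra.

Unset Implicit Arguments.

(* hF3 excludes only the field with three elements, over which the Peirce
   rule fails when palintropicity is an identity between values: take
   A = F_3 c + F_3 e + F_3 y with cc = c, ee = e, cy = ey = y, ce = yy = 0;
   then e is in A_c(0), y is in A_c(1), but ey = y is not in A_c(0). *)
Theorem theorem6p1 (F : fieldType) (hchar : 2%N \notin [pchar F])
    (hF3 : exists a : F, a \notin [:: 0; 1; -1])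
    (A : lmodType F) (mul : {bilinear A -> A -> A}) (mulC : commutative mul)
    (hpal : palintropic23 mul) (c : A) (hc : Idm mul c) :
  (forall lam mu : F,
      spectrum mul c lam -> lam != 2%:R^-1 ->
      spectrum mul c mu -> mu != 2%:R^-1 ->
      forall z : A, prod_span mul (peirce mul c lam) (peirce mul c mu) z ->
        z \in peirce mul c (lam * mu)) /\
  (subalgebra mul (peirce mul c 0) /\ subalgebra mul (peirce mul c 1)) /\
  (nonsingular mul c ->
      (forall x : A, (x \in peirce mul c 0) = (Lop mul c x == 0)) /\
      ideal mul (peirce mul c 0)) /\
  (forall (x : A) (lam : F), x \in peirce mul c lam -> lam != 2%:R^-1 ->
      forall d : namonomial,
        mul c (napow mul x d) = lam ^+ nadeg d *: napow mul x d).
Proof.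
have n2 : (2 : F) != 0 by apply: contra hchar => n2; rewrite inE /= n2.
have [cc _] := hc.
split; last split; last split.
- move=> lam mu _ hlam _ hmu z; exact: (peirce_prod_span mulC hpal cc n2 hF3).
- split; apply: (peirce_subalgebra mulC hpal cc n2 hF3); rewrite ?mulr0 ?mulr1 //.
    by rewrite eq_sym invr_eq0.
  rewrite (ne_half n2) mulr1 (_ : 1 - 2 = -1 :> F); last by ring.
  by rewrite oppr_eq0 oner_eq0.
- move=> ns; split; last exact: (peirce0_ideal mulC hpal cc n2 hF3).
  by move=> x; rewrite inE scale0r subr0.
- move=> x lam xlam hlam d; exact: (napow_peirce mulC hpal cc n2 hF3).
Qed.
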